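(* Let $a_{0},a_{1},\dots,a_{n}$ be integers with $a_0a_n\neq 0$ and $|a_0|>\sum_{i=1}^{n}|a_{i}|2^i$, and for $j\in\{0,1,2\}$ let $$S_{j}=\sum_{\substack{0\le i\le n\\ i\equiv j\ (\mathrm{mod}\ 3)}}a_{i}.$$ If $S_0^2+S_1^2+S_2^2-S_0S_1-S_0S_2-S_1S_2$ is a prime number, then the polynomial $\sum_{i=0}^{n}a_{i}X^{i}$ is irreducible over $\mathbb{Q}$. *)

(* Defs.v *)
From mathcomp Require Import all_boot all_order all_algebra.
Set Implicit Arguments.
Unset Strict Implicit.
Unset Printing Implicit Defensive.

Import Order.TTheory GRing.Theory Num.Theory.
Local Open Scope ring_scope.

(* The integers a_0, ..., a_n are the values of a : nat -> int at 0, ..., n;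
   values of a beyond n play no role. *)
Definition residue_sum (a : nat -> int) (n j : nat) : int :=
  \sum_(0 <= i < n.+1 | i == j %[mod 3]) a i.

(* Main.v *)
Require Import Defs.
From mathcomp Require Import all_boot all_order all_algebra.
From mathcomp Require Import all_field.
From mathcomp Require Import ring.
Set Implicit Arguments.
Unset Strict Implicit.
Unset Printing Implicit Defensive.

Import Order.TTheory GRing.Theory Num.Theory.
Local Open Scope ring_scope.

(** Evaluate the polynomial f at a primitive cube root of unity w.  Reducing
    exponents modulo 3 gives f(w) = S_0 + S_1 w + S_2 w^2, and the quadratic
    form in the hypothesis is exactly |f(w)|^2, the norm of f(w) from Q(w) to Q
    ([horner_cube_root], [norm_eisenstein]).  The same computation applies to
    every integer polynomial g, so |g(w)|^2 is always a natural number.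

    The dominance of a_0 forces all complex roots of f to lie outside the
    closed disc of radius 2 ([root_norm_gt]).  Hence the roots of any factor g
    of f are at distance more than 1 from the unit circle, and an integer
    factor of positive degree satisfies |g(w)| > 1 ([factor_norm_gt1]), because
    g(w) is its leading coefficient, a nonzero integer, times a nonempty
    product of factors of modulus greater than 1.

    By Gauss's lemma ([irreducible_poly_rat_of_int]) a proper factorization of
    f over Q yields f = g h with g, h integer polynomials of positive degree.
    Then the prime |f(w)|^2 is the product of the natural numbers |g(w)|^2 and
    |h(w)|^2, both greater than 1, which is absurd. *)

Notation ZtoC p := (map_poly (intr : int -> algC) p).
Notation ZtoQ p := (map_poly (intr : int -> rat) p).

(** The norm from Q(w) to Q of x + y w + z w^2, for w a primitive cube root
    of unity. *)
Definition eisenstein_norm (x y z : int) : int :=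
  x ^+ 2 + y ^+ 2 + z ^+ 2 - x * y - x * z - y * z.

Lemma mul_gt1_not_prime (m k : nat) :
  (1 < m)%N -> (1 < k)%N -> ~~ prime (m * k).
Proof.
move=> m1 k1; apply/negP => /primeP[_ /(_ m)].
rewrite dvdn_mulr // => /(_ isT).
rewrite (gtn_eqF m1) /= -[X in X == _]muln1 eqn_pmul2l 1?ltnW //.
by rewrite (ltn_eqF k1).
Qed.

(** * Location of the roots *)

(** At a root z with |z| <= r the constant term would be minus the sum of the
    other terms, whose modulus the triangle inequality bounds by the value at r
    of the polynomial with coefficients |c_i|. *)
Lemma root_norm_gt (n : nat) (c : nat -> algC) (r z : algC) :
  0 <= r -> \sum_(1 <= i < n.+1) `|c i| * r ^+ i < `|c 0%N| ->
  root (\poly_(i < n.+1) c i) z -> r < `|z|.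
Proof.
move=> r0 dom; rewrite rootE horner_poly.
rewrite -(big_mkord xpredT (fun i => c i * z ^+ i)).
rewrite big_nat_recl // expr0 mulr1 addr_eq0 => /eqP c0E.
rewrite real_ltNge ?normr_real ?ger0_real //.
apply/negP => zr; move: dom; rewrite c0E normrN big_add1 /=.
rewrite real_ltNge ?normr_real //; last first.
  by apply: ger0_real; apply: sumr_ge0 => i _; rewrite mulr_ge0 ?exprn_ge0.
case/negP; apply: le_trans (ler_norm_sum _ _ _) _.
apply: ler_sum => i _; rewrite normrM normrX ler_wpM2l //.
by rewrite lerXn2r // nnegrE.
Qed.

(** In the factorization of g into linear factors, each factor of g(u) satisfies
    |u - z| >= |z| - |u| > 1. *)
Lemma horner_norm_gt1 (g : {poly algC}) (u : algC) :
  `|u| = 1 -> 1 <= `|lead_coef g| -> (1 < size g)%N ->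
  (forall z, root g z -> 2 < `|z|) -> 1 < `|g.[u]|.
Proof.
move=> u1 lc1 sg hr; have [s gE] := closed_field_poly_normal g.
have lc0 : lead_coef g != 0.
  by rewrite lead_coef_eq0 -size_poly_gt0 (ltn_trans _ sg).
have hs z : z \in s -> 2 < `|z|.
  by move=> zs; apply: hr; rewrite gE rootZ // root_prod_XsubC.
have : (0 < size s)%N.
  by move: sg; rewrite gE size_scale // size_prod_XsubC ltnS.
have -> : `|g.[u]| = `|lead_coef g| * \prod_(z <- s) `|u - z|.
  rewrite {1}gE hornerZ horner_prod normrM normr_prod; congr (_ * _).
  by apply: eq_bigr => z _; rewrite !hornerE.
move=> s0; suff P1 : 1 < \prod_(z <- s) `|u - z|.
  by apply: lt_le_trans P1 _; rewrite ler_peMl // prodr_ge0.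
elim: s s0 hs {gE} => // z s IH _ hs; rewrite big_cons.
have z1 : 1 < `|u - z|.
  rewrite distrC; apply: lt_le_trans (lerB_dist _ _).
  by rewrite u1 ltrBrDr hs // mem_head.
case: s IH hs => [|y s] IH hs; first by rewrite big_nil mulr1.
rewrite -[X in X < _]mul1r ltr_pM // IH // => x xs.
by apply: hs; rewrite inE xs orbT.
Qed.

(** The hypothesis bears on the roots of the product g h, which is where a
    dominance condition on coefficients gives information. *)
Lemma factor_norm_gt1 (u : algC) (g h : {poly int}) :
  `|u| = 1 -> (forall z, root (ZtoC (g * h)) z -> 2 < `|z|) ->
  (1 < size g)%N -> 1 < `|(ZtoC g).[u]|.
Proof.
have inj : injective (intr : int -> algC) by exact: intr_inj.
move=> u1 hr sg; apply: horner_norm_gt1 => //.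
- rewrite lead_coef_map_inj //; apply: norm_intr_ge1; first exact: rpred_int.
  by rewrite intr_eq0 lead_coef_eq0 -size_poly_gt0 ltnW.
- by rewrite size_map_inj_poly.
- by move=> z gz; apply: hr; rewrite rmorphM rootM gz.
Qed.

(** * Values at a primitive cube root of unity *)

Lemma cube_root_sum (w : algC) :
  3.-primitive_root w -> w ^+ 2 + w + 1 = 0.
Proof.
move=> w3; have w31 := prim_expr_order w3.
have w1 : w - 1 != 0 by rewrite subr_eq0 -[w]expr1 -(prim_order_dvd w3).
apply: (mulfI w1); rewrite mulr0; transitivity (w ^+ 3 - 1); first by ring.
by rewrite w31 subrr.
Qed.

Lemma cube_root_norm (w : algC) : 3.-primitive_root w -> `|w| = 1.
Proof.
move=> w3; apply/eqP.
by rewrite -(@pexpr_eq1 _ _ 3) // -normrX (prim_expr_order w3) normr1.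
Qed.

Lemma horner_cube_root (w : algC) (n : nat) (a : nat -> int) :
  3.-primitive_root w ->
  (ZtoC (\poly_(i < n.+1) a i)).[w] =
    (residue_sum a n 0)%:~R + (residue_sum a n 1)%:~R * w
      + (residue_sum a n 2)%:~R * w ^+ 2.
Proof.
move=> w3; have -> : (ZtoC (\poly_(i < n.+1) a i)).[w]
    = \sum_(0 <= i < n.+1) (a i)%:~R * w ^+ i.
  rewrite poly_def rmorph_sum horner_sum big_mkord; apply: eq_bigr => i _.
  by rewrite /= map_polyZ map_polyXn hornerZ hornerXn.
rewrite /residue_sum !rmorph_sum /= !mulr_suml.
rewrite [in RHS]big_mkcond [X in _ + X + _]big_mkcond.
rewrite [X in _ + _ + X]big_mkcond -!big_split /=.
apply: eq_bigr => i _; rewrite /= -(expr_mod i (prim_expr_order w3)).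
have := ltn_pmod i (isT : 0 < 3)%N.
by case: (i %% 3)%N => [|[|[|]]] //= _; rewrite ?(mulr1, addr0, add0r).
Qed.

(** Conjugation exchanges w and w^2, so the squared modulus is
    (x + y w + z w^2) (x + y w^2 + z w), to be reduced by w^2 + w + 1 = 0. *)
Lemma norm_eisenstein (w : algC) (x y z : int) :
  3.-primitive_root w ->
  `|x%:~R + y%:~R * w + z%:~R * w ^+ 2| ^+ 2 = (eisenstein_norm x y z)%:~R.
Proof.
move=> w3; have w31 := prim_expr_order w3.
have wC : w^* = w ^+ 2.
  have w0 : w != 0 by rewrite -normr_eq0 cube_root_norm ?oner_eq0.
  by apply: (mulfI w0); rewrite -normCK cube_root_norm // expr1n -exprS w31.
rewrite normCK !(rmorphD Num.conj) !(rmorphM Num.conj _%:~R).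
rewrite (rmorphXn Num.conj) /= !rmorph_int wC.
have -> : (w ^+ 2) ^+ 2 = w by rewrite -exprM (exprD w 3 1) w31 mul1r.
apply/eqP; rewrite -subr_eq0 /eisenstein_norm.
rewrite !(rmorphB, rmorphD, rmorphM, rmorphXn) /=.
have -> : w ^+ 2 = - w - 1.
  by apply/eqP; rewrite -subr_eq0 -(cube_root_sum w3); apply/eqP; ring.
(* The cofactor is the quotient of the difference of the two sides, now a
   quadratic polynomial in w, by w^2 + w + 1. *)
apply/eqP; transitivity (- (y%:~R - z%:~R) ^+ 2 * (w ^+ 2 + w + 1)).
  by ring.
by rewrite cube_root_sum // mulr0.
Qed.

Lemma norm_horner_nat (w : algC) (g : {poly int}) :
  3.-primitive_root w -> exists m : nat, `|(ZtoC g).[w]| ^+ 2 = m%:R.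
Proof.
move=> w3; have -> : g = \poly_(i < (size g).+1) g`_i.
  apply/polyP=> i; rewrite coef_poly ltnS; case: leqP => // si.
  by rewrite nth_default // ltnW.
rewrite horner_cube_root // norm_eisenstein //.
set N := eisenstein_norm _ _ _.
have : 0 <= N by rewrite -(ler0z algC) -(norm_eisenstein _ _ _ w3) exprn_ge0.
by case: N => // m _; exists m.
Qed.

(** * Descent from rational to integer factorizations *)

(** Gauss's lemma: after clearing denominators, the primitive part of a rational
    divisor divides f over the integers and has the same degree. *)
Lemma irreducible_poly_rat_of_int (f : {poly int}) :
  (1 < size f)%N ->
  (forall g h : {poly int},
     f = g * h -> (1 < size g)%N -> (1 < size h)%N -> False) ->
  irreducible_poly (ZtoQ f).
Proof.
move=> sf noF; split=> [|q sq qf]; first by rewrite size_rat_int_poly.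
have f0 : f != 0 by rewrite -size_poly_gt0 ltnW.
have [g [b b0 qE]] := rat_poly_scale q.
have sqg : size q = size g.
  by rewrite qE size_scale ?invr_eq0 ?intr_eq0 // size_rat_int_poly.
move: (qf); rewrite {1}qE dvdpZl ?invr_eq0 ?intr_eq0 // dvdp_rat_int => gf.
have [h fE] := dvdpP_int gf.
have : g != 0 by apply: contraTneq gf => ->; rewrite dvd0p.
rewrite -size_poly_gt0 => g0.
have h0 : (0 < size h)%N.
  by rewrite size_poly_gt0; apply: contra_neq f0 => hE; rewrite fE hE mulr0.
have sg1 : (1 < size g)%N by rewrite ltn_neqAle eq_sym -sqg sq sqg.
have [sh|sh] := ltnP 1 (size h).
  by case: (noF _ _ fE) => //; rewrite size_zprimitive.
(* The cofactor h is constant, so q and f have the same degree. *)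
rewrite -dvdp_size_eqp // size_rat_int_poly fE.
rewrite size_mul -?size_poly_gt0 ?size_zprimitive //.
by rewrite sqg; move: sh h0; case: (size h) => [|[|]] // _ _; rewrite addn1.
Qed.

(** * Irreducibility *)

Theorem theoremC (n : nat) (a : nat -> int)
  (ha : a 0%N * a n != 0)
  (hdom : `|a 0%N| > \sum_(1 <= i < n.+1) `|a i| * 2 ^+ i)
  (hprime : let S := residue_sum a n in
    exists p : nat, prime p /\
      S 0%N ^+ 2 + S 1%N ^+ 2 + S 2%N ^+ 2
        - S 0%N * S 1%N - S 0%N * S 2%N - S 1%N * S 2%N = p%:Z) :
  irreducible_poly (\sum_(0 <= i < n.+1) (a i)%:~R *: 'X^i : {poly rat}).
Proof.
case: hprime => p [pr_p]; rewrite -/(eisenstein_norm _ _ _) => normE.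
have [w w3] := C_prim_root_exists (isT : 0 < 3)%N.
set f := \poly_(i < n.+1) a i.
have an0 : a n != 0 by move: ha; rewrite mulf_eq0 negb_or => /andP[].
have -> : \sum_(0 <= i < n.+1) (a i)%:~R *: 'X^i = ZtoQ f.
  rewrite /f poly_def rmorph_sum big_mkord; apply: eq_bigr => i _.
  by rewrite /= map_polyZ map_polyXn.
have sf : size f = n.+1 by rewrite size_poly_eq.
have fp : `|(ZtoC f).[w]| ^+ 2 = p%:R.
  by rewrite horner_cube_root // norm_eisenstein // normE.
have rf z : root (ZtoC f) z -> 2 < `|z|.
  have -> : ZtoC f = \poly_(i < n.+1) (a i)%:~R.
    by apply/polyP=> i; rewrite coef_map !coef_poly; case: ifP.
  apply: root_norm_gt => //.
  move: hdom; rewrite -(ltr_int algC) rmorph_sum /= intr_norm.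
  by under eq_bigr do rewrite rmorphM rmorphXn /= intr_norm.
apply: irreducible_poly_rat_of_int.
  (* For n = 0 the prime would be the square of a_0. *)
  rewrite sf ltnS lt0n; apply/eqP => n0; move: normE pr_p.
  have S0E j : residue_sum a 0 j = if 0%N == j %[mod 3] then a 0%N else 0.
    by rewrite /residue_sum big_mkcond big_nat1.
  rewrite n0 !S0E /eisenstein_norm /=.
  rewrite expr0n /= !addr0 !mulr0 !subr0 => /(congr1 absz).
  rewrite abszX absz_nat => <-; case: `|a 0%N|%N => [|[|m]] //.
  by rewrite -mulnn; apply/negP; rewrite mul_gt1_not_prime.
move=> g h fE sg sh.
have [m gm] := norm_horner_nat g w3; have [k hk] := norm_horner_nat h w3.
have w1 := cube_root_norm w3.
have g1 : 1 < `|(ZtoC g).[w]|.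
  by apply: (@factor_norm_gt1 _ _ h) => //; rewrite -fE.
have h1 : 1 < `|(ZtoC h).[w]|.
  by apply: (@factor_norm_gt1 _ _ g) => //; rewrite mulrC -fE.
have m1 : (1 < m)%N by rewrite -(ltr_nat algC) -gm exprn_egt1.
have k1 : (1 < k)%N by rewrite -(ltr_nat algC) -hk exprn_egt1.
have pE : p = (m * k)%N.
  apply/eqP; rewrite -(eqr_nat algC) natrM -gm -hk -fp fE.
  by rewrite rmorphM hornerM normrM exprMn.
by move: pr_p; rewrite pE; apply/negP; exact: mul_gt1_not_prime.
Qed.
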